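(* Suppose that $\mathfrak g$ is a Lie algebra. The following conditions are equivalent: (a) There is an inner product on $\mathfrak g$ for which every nonzero element is a geodesic. (b) $\mathfrak g$ is isomorphic to the direct sum of an abelian Lie algebra and a semisimple Lie algebra of compact type.
   Context: All Lie algebras are finite-dimensional and over $\mathbb R$. Given an inner product $\langle\cdot,\cdot\rangle$ on a Lie algebra $\mathfrak g$ (arbitrary; no compatibility with the bracket is assumed), the Levi-Civita connection $\nabla$ is given by $2\langle\nabla_XY,Z\rangle=\langle[X,Y],Z\rangle+\langle[Z,X],Y\rangle+\langle[Z,Y],X\rangle$ for all $X,Y,Z\in\mathfrak g$. A subalgebra $\mathfrak h$ of $\mathfrak g$ is totally geodesic if $\nabla_YZ\in\mathfrak h$ for all $Y,Z\in\mathfrak h$. A nonzero element $Y\in\mathfrak g$ (not necessarily of unit length) is called a geodesic if the one-dimensional subalgebra $\operatorname{Span}(Y)$ is totally geodesic. A semisimple Lie algebra is of compact type if its Killing form is negative definite. Either summand in (b) may be zero. *)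

(* Defs.v *)
From HB Require Import structures.
From mathcomp Require Import all_boot all_order all_algebra.
From mathcomp Require Import ring boolp classical_sets reals.

Set Implicit Arguments.
Unset Strict Implicit.
Unset Printing Implicit Defensive.

Import Order.TTheory GRing.Theory Num.Theory.
Local Open Scope ring_scope.

HB.mixin Record Vector_isLie (R : fieldType) L & Vector R L := {
  lie_bracket : L -> L -> L;
  lie_bracket_is_bilinear :
    (forall y, linear (lie_bracket^~ y)) * (forall x, linear (lie_bracket x));
  lie_bracketxx : forall x, lie_bracket x x = 0;
  lie_jacobi : forall x y z,
    lie_bracket x (lie_bracket y z) + lie_bracket y (lie_bracket z x)
      + lie_bracket z (lie_bracket x y) = 0
}.

#[short(type="lieAlgType")]
HB.structure Definition LieAlgebra (R : fieldType) :=
  { L of Vector_isLie R L & Vector R L }.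

Notation "[ 'Lie' x , y ]" := (lie_bracket x y)
  (at level 0, x, y at level 99, format "[ 'Lie'  x ,  y ]") : ring_scope.

HB.instance Definition _ (R : fieldType) (g : lieAlgType R) :=
  bilinear_isBilinear.Build R g g g _ _ (@lie_bracket R g)
    lie_bracket_is_bilinear.

Section DirectSum.
Variables (R : fieldType) (g h : lieAlgType R).

Definition pair_bracket (u v : g * h) : g * h :=
  ([Lie u.1, v.1], [Lie u.2, v.2]).

Fact pair_bracket_is_bilinear :
  (forall y, linear (pair_bracket^~ y)) * (forall x, linear (pair_bracket x)).
Proof.
split=> [[w1 w2]|[w1 w2]] a [u1 u2] [v1 v2]; rewrite /pair_bracket /=.
  by rewrite !linearPl.
by rewrite !linearPr.
Qed.

Fact pair_bracketxx x : pair_bracket x x = 0.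
Proof. by rewrite /pair_bracket !lie_bracketxx. Qed.

Fact pair_jacobi x y z :
  pair_bracket x (pair_bracket y z) + pair_bracket y (pair_bracket z x)
    + pair_bracket z (pair_bracket x y) = 0.
Proof. by congr (_, _); rewrite /= lie_jacobi. Qed.

HB.instance Definition _ := Vector_isLie.Build R (g * h)%type
  pair_bracket_is_bilinear pair_bracketxx pair_jacobi.

End DirectSum.

Section LieAlgebraTheory.
Variables (R : fieldType).
Implicit Types g h : lieAlgType R.

Definition lie_isomorphic g h : Prop :=
  exists f : {linear g -> h},
    bijective f /\ forall x y, f [Lie x, y] = [Lie f x, f y].

Definition lie_abelian g : Prop := forall x y : g, [Lie x, y] = 0.

Definition lie_subalgebra g (U : {vspace g}) : Prop :=
  forall x y, x \in U -> y \in U -> [Lie x, y] \in U.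

Definition lie_ideal g (I : {vspace g}) : Prop :=
  forall x y, y \in I -> [Lie x, y] \in I.

(* By bilinearity this is the span of all the [Lie x, y] with x in U and y in V,
   see mem_lie_commutator. *)
Definition lie_commutator g (U V : {vspace g}) : {vspace g} :=
  <<[seq [Lie x, y] | x <- vbasis U, y <- vbasis V]>>%VS.

Definition derived_series g (U : {vspace g}) (n : nat) : {vspace g} :=
  iter n (fun V => lie_commutator V V) U.

Definition lie_solvable g (U : {vspace g}) : Prop :=
  exists n, derived_series U n = 0%VS.

(* Equivalently the radical, which is the largest solvable ideal, vanishes; in
   particular the zero Lie algebra counts as semisimple. *)
Definition lie_semisimple g : Prop :=
  forall I : {vspace g}, lie_ideal I -> lie_solvable I -> I = 0%VS.

Definition ad g (x : g) : 'End(g) := linfun (lie_bracket x).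

Definition lfun_trace (V : vectType R) (f : 'End(V)) : R :=
  \tr (passmx.mxof (vbasis {:V}) (vbasis {:V}) f).

Definition killing_form g (x y : g) : R := lfun_trace (ad x \o ad y)%VF.

Lemma mem_lie_commutator g (U V : {vspace g}) x y :
  x \in U -> y \in V -> [Lie x, y] \in lie_commutator U V.
Proof.
move=> xU yV; rewrite (coord_vbasis xU) (coord_vbasis yV) linear_sumlz.
apply: rpred_sum => i _; rewrite linear_sumr; apply: rpred_sum => j _.
rewrite linearZl_LR linearZr_LR; do 2!apply: rpredZ.
by apply/memv_span/allpairs_f; apply: mem_nth; rewrite size_tuple.
Qed.

Lemma lfun_trace_basis (V : vectType R) (e : (\dim {:V}).-tuple V)
    (f : 'End(V)) :
  basis_of {:V} e -> lfun_trace f = \tr (passmx.mxof e e f).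
Proof.
move=> eB; have bB := vbasisP {:V}; rewrite /lfun_trace.
rewrite -{1}[f]comp_lfun1r (passmx.mxof_comp _ _ eB) -{1}[f]comp_lfun1l.
rewrite (passmx.mxof_comp _ _ eB) mxtrace_mulC -mulmxA.
rewrite -(passmx.mxof_comp _ _ bB) comp_lfun1l passmx.mxof1 ?(basis_free eB) //.
by rewrite mulmx1.
Qed.

End LieAlgebraTheory.

Definition compact_type (R : realFieldType) (g : lieAlgType R) : Prop :=
  forall x : g, x != 0 -> killing_form x x < 0.

(* With the trivial involution the library's Hermitian forms are the symmetric
   bilinear ones, so this is a symmetric positive definite bilinear form. *)
Notation innerProduct g := {dot g for idfun}.

Section LeviCivita.
Variables (R : realType) (g : lieAlgType R) (ip : innerProduct g).
Implicit Types (X Y Z W : g) (U : {vspace g}).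

Definition koszul X Y W : Prop := forall Z,
  2 * ip W Z = ip [Lie X, Y] Z + ip [Lie Z, X] Y + ip [Lie Z, Y] X.

(* The default value 0 is never used: by levi_civitaP and koszul_uniq below,
   exactly one W satisfies koszul X Y W. *)
Definition levi_civita X Y : g := xget 0 [set W | koszul X Y W]%classic.

Definition totally_geodesic U : Prop :=
  lie_subalgebra U /\
  forall Y Z, Y \in U -> Z \in U -> levi_civita Y Z \in U.

Definition geodesic Y : Prop := Y != 0 /\ totally_geodesic <[Y]>%VS.

Lemma dot_representation (phi : {linear g -> R^o}) :
  exists W, forall Z, ip W Z = phi Z.
Proof.
pose flat1 W : 'Hom(g, R^o) := linfun (ip W : g -> R^o).
have flat1E W Z : flat1 W Z = ip W Z by rewrite lfunE.
have flat1_lin : linear flat1.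
  move=> a u v; apply/lfunP => Z; rewrite add_lfunE scale_lfunE !flat1E.
  by rewrite linearPl.
pose flatM := GRing.isSemilinear.Build _ _ _ _ flat1
  (GRing.semilinear_linear flat1_lin).
pose flatL : {linear g -> 'Hom(g, R^o)} := HB.pack flat1 flatM.
pose flat := linfun flatL.
have flatE W : flat W = flat1 W by rewrite lfunE.
have ker0 : lker flat = 0%VS.
  apply/eqP; rewrite -subv0; apply/subvP => W; rewrite memv_ker memv0.
  rewrite flatE => /eqP/lfunP/(_ W); rewrite flat1E zero_lfunE => W0.
  by apply: contraT => /(@neq0_dnorm_gt0 _ _ _ ip); rewrite W0 ltxx.
have full : limg flat = fullv.
  apply/eqP; rewrite eqEdim subvf /= limg_dim_eq ?ker0 ?capv0 //.
  by rewrite !dimvf /dim /= muln1.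
have /memv_imgP[W _ phiE] : linfun phi \in limg flat by rewrite full memvf.
by exists W => Z; rewrite -flat1E -flatE -phiE lfunE.
Qed.

Lemma koszul_uniq X Y W1 W2 : koszul X Y W1 -> koszul X Y W2 -> W1 = W2.
Proof.
move=> k1 k2; apply/eqP; rewrite -subr_eq0; apply: contraT.
move=> /(@neq0_dnorm_gt0 _ _ _ ip); rewrite linearBl /=.
suff -> : ip W1 (W1 - W2) = ip W2 (W1 - W2) by rewrite subrr ltxx.
by apply: (@mulfI _ 2); rewrite ?pnatr_eq0 // k1 k2.
Qed.

Lemma levi_civitaP X Y : koszul X Y (levi_civita X Y).
Proof.
apply: xgetPex.
pose phi Z : R^o :=
  2^-1 * (ip [Lie X, Y] Z + ip [Lie Z, X] Y + ip [Lie Z, Y] X).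
have phi_lin : linear phi.
  move=> a u v; rewrite /phi linearPr !linearPl /= -![a *: _]/(a * _) /=.
  by ring.
pose phiM := GRing.isSemilinear.Build _ _ _ _ phi
  (GRing.semilinear_linear phi_lin).
pose phiL : {linear g -> R^o} := HB.pack phi phiM.
have [W WE] := dot_representation phiL; exists W => Z.
by rewrite WE /= /phi mulVKf ?pnatr_eq0.
Qed.

End LeviCivita.

(* Main.v *)
Require Import Defs.
From HB Require Import structures.
From mathcomp Require Import all_boot all_order all_algebra.
From mathcomp Require Import reals.

(** If every line of g is totally geodesic, then nabla_Y Y is a multiple of Y;
    as the Koszul formula makes it orthogonal to Y, it vanishes, and the same
    formula then reads <[X, Y], Y> = 0 for all X and Y. So all nonzero elements
    are geodesics exactly when every ad X is skew-adjoint, that is, when the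
    inner product is invariant ([all_geodesicP]), and it remains to see which
    Lie algebras carry an invariant inner product.

    Given one, the orthogonal complement d of the centre z contains all
    brackets, since <[x, y], c> = - <y, [x, c]> = 0 for c central. Hence g is
    the direct sum of the commuting subalgebras z and d, and d has trivial
    centre. For a nonzero skew-adjoint map f the trace of f^2 is negative, being
    the sum of - |f e_i|^2 / |e_i|^2 over an orthogonal basis
    ([trace_sqr_skew_lt0]); taking f = ad x, the Killing form of d is negative
    definite. This already makes d semisimple: an element x of an abelian ideal
    has (ad x)^2 = 0, hence K(x, x) = 0 ([compact_type_semisimple]).

    Conversely, minus the Killing form is an invariant inner product on an
    algebra of compact type, and any inner product is invariant on an abelian
    algebra; their orthogonal sum, pulled back along the isomorphism, is an
    invariant inner product on g. *)

Set Implicit Arguments.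
Unset Strict Implicit.
Unset Printing Implicit Defensive.

Import Order.TTheory GRing.Theory Num.Theory.
Import passmx.

Local Open Scope ring_scope.

(** * Inner products on vector spaces over an ordered field *)

Section InnerProduct.
Variables (R : realFieldType) (V : vectType R).
Implicit Types (ip : {dot V for idfun}) (u v : V) (U : {vspace V}).

Lemma dot_of_form (b : V -> V -> R) :
    (forall v, scalar (b^~ v)) -> (forall u v, b u v = b v u) ->
    (forall v, v != 0 -> 0 < b v v) ->
  exists ip, forall u v, ip u v = b u v.
Proof.
move=> b_lin b_sym b_pos.
have b_bilin : bilinear_for *%R (idfun \; *%R) b.
  split=> [v|u] a x y; first exact: b_lin.
  by rewrite ![b u _]b_sym b_lin.
pose bB := bilinear_isBilinear.Build R V V R _ _ b b_bilin.
have b_herm u v : b u v = (-1) ^+ false * idfun (b v u).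
  by rewrite mul1r b_sym.
pose bH := isHermitianSesquilinear.Build R V false idfun b b_herm.
pose bP := isDotProduct.Build R V b b_pos.
pose ip : {dot V for idfun} := HB.pack b bB bH bP.
by exists ip.
Qed.

Lemma exists_dot : inhabited {dot V for idfun}.
Proof.
pose b (u v : V) := \sum_i coord (vbasis {:V}) i u * coord (vbasis {:V}) i v.
have [v a x y||v v_neq0|ip _] := @dot_of_form b; last by exists.
- rewrite /b mulr_sumr -big_split; apply: eq_bigr => i _ /=.
  by rewrite linearP mulrDl mulrA.
- by move=> u v; apply: eq_bigr => i _; rewrite mulrC.
rewrite lt_def sumr_ge0 ?andbT => [|i _]; last exact: sqr_ge0.
apply: contraNneq v_neq0 => b0; apply/eqP.
rewrite (coord_vbasis (memvf v)) big1 // => i _.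
have sq_ge0 j of xpredT j := sqr_ge0 (coord (vbasis {:V}) j v).
have /eqP := psumr_eq0P sq_ge0 b0 (i := i) isT.
by rewrite sqrf_eq0 => /eqP ->; rewrite scale0r.
Qed.

Lemma dot_sym ip u v : ip u v = ip v u.
Proof. by rewrite hermC mul1r. Qed.

Lemma dot_eq0 ip u : (ip u u == 0) = (u == 0).
Proof.
apply/eqP/eqP=> [uu0|->]; last by rewrite linear0r.
by apply: contraTeq isT => /(@neq0_dnorm_gt0 _ _ _ ip); rewrite uu0 ltxx.
Qed.

Lemma dot_ge0 ip u : 0 <= ip u u.
Proof.
have [->|/(@neq0_dnorm_gt0 _ _ _ ip)/ltW//] := eqVneq u 0.
by rewrite linear0r.
Qed.

(** The basis is not normalised, so that no square roots are needed and the
    scalars can form any ordered field. *)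
Lemma orthogonal_basis ip U :
  exists e : (\dim U).-tuple V, basis_of U e /\
    forall i j : 'I_(\dim U), i != j -> ip e`_i e`_j = 0.
Proof.
suff [e [eU e_orth]] : exists e : seq V, basis_of U e /\
    forall i j, (i < size e)%N -> (j < size e)%N -> i != j -> ip e`_i e`_j = 0.
  have size_e := size_basis (X := in_tuple e) eU.
  have sz : size e == \dim U by rewrite size_e.
  by exists (Tuple sz); split=> // i j; apply: e_orth; rewrite -size_e ltn_ord.
(* A nonzero u in U is completed by an orthogonal basis of U :&: u^perp, which
   has codimension 1 in U because u itself is not orthogonal to U. *)
elim: {U}(\dim U) {-2}U (erefl (\dim U)) => [|n IHn] U dimU.
  exists [::]; split=> //; rewrite basisEfree nil_free span_nil sub0v /=.
  by rewrite dimU.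
pose u := vpick U.
have u_neq0 : u != 0 by rewrite vpick0 -dimv_eq0 dimU.
have uU : u \in U := memv_pick U.
have uNperp : u \notin orthov ip U.
  by apply/mem_orthovPn; exists u; rewrite ?dot_eq0.
pose W := (U :&: orthov ip <[u]>)%VS.
have [e [eB e_orth]] : exists e : seq V, basis_of W e /\
    forall i j, (i < size e)%N -> (j < size e)%N -> i != j -> ip e`_i e`_j = 0.
  by apply: IHn; rewrite -(eq_dim_orthov1 uNperp) dimU.
have u_e x : x \in e -> ip x u = 0.
  move=> /(basis_mem eB); rewrite memv_cap => /andP[_].
  by rewrite mem_orthov1 => /eqP.
have uNW : u \notin W.
  by rewrite memv_cap uU mem_orthov1 dot_eq0.
exists (u :: e); split.
  rewrite basisEfree free_cons (basis_free eB) span_cons (span_basis eB) andbT.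
  rewrite uNW subv_add -memvE uU capvSl dimU /=.
  by rewrite -(size_basis (X := in_tuple e) eB) -(eq_dim_orthov1 uNperp) dimU.
have e_u x : x \in e -> ip u x = 0 by move/u_e; rewrite dot_sym.
move=> [|i] [|j] //= ltie ltje neq_ij.
- by rewrite e_u ?mem_nth.
- by rewrite u_e ?mem_nth.
- exact: e_orth.
Qed.

Section OrthogonalCoordinates.
Variables (ip : {dot V for idfun}) (U : {vspace V}) (e : (\dim U).-tuple V).
Hypothesis eU : basis_of U e.
Hypothesis e_orth : forall i j : 'I_(\dim U), i != j -> ip e`_i e`_j = 0.

Lemma dot_orthogonal_sum (c : 'I_(\dim U) -> R) (i : 'I_(\dim U)) :
  ip (\sum_j c j *: e`_j) e`_i = c i * ip e`_i e`_i.
Proof.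
rewrite linear_sumlz (bigD1 i) //= linearZl_LR big1 ?addr0 // => j neq_ji.
by rewrite linearZl_LR /= e_orth ?mulr0.
Qed.

Lemma orthogonal_basis_gt0 (i : 'I_(\dim U)) : 0 < ip e`_i e`_i.
Proof. by apply/neq0_dnorm_gt0/(basis_not0 eU)/mem_nth; rewrite size_tuple. Qed.

Lemma orthogonal_coord v (i : 'I_(\dim U)) :
  v \in U -> coord e i v = ip v e`_i / ip e`_i e`_i.
Proof.
move=> /(coord_basis eU) {2}->; rewrite dot_orthogonal_sum.
by rewrite mulfK // gt_eqF ?orthogonal_basis_gt0.
Qed.

(** The sum is the orthogonal projection of [v] onto [U]. *)
Lemma sub_projection_orthov v :
  v - \sum_(i < \dim U) (ip v e`_i / ip e`_i e`_i) *: e`_i \in orthov ip U.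
Proof.
apply/mem_orthovP => u /(coord_basis eU) ->.
rewrite linear_sumr big1 // => i _; rewrite linearZr_LR linearBl /=.
rewrite dot_orthogonal_sum mulfVK ?subrr ?mulr0 //.
by rewrite gt_eqF ?orthogonal_basis_gt0.
Qed.

End OrthogonalCoordinates.

Lemma capv_orthov ip U : (U :&: orthov ip U = 0)%VS.
Proof.
apply/eqP; rewrite -subv0; apply/subvP => u; rewrite memv_cap memv0.
by case/andP => uU /mem_orthovP/(_ u uU)/eqP; rewrite dot_eq0.
Qed.

Lemma addv_orthov ip U : (U + orthov ip U = fullv)%VS.
Proof.
apply/eqP; rewrite eqEsubv subvf; apply/subvP => v _.
have [e [eU e_orth]] := orthogonal_basis ip U.
pose w := \sum_(i < \dim U) (ip v e`_i / ip e`_i e`_i) *: e`_i.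
rewrite -(subrKC w v) memv_add ?sub_projection_orthov //.
apply: rpred_sum => i _; apply/rpredZ/(basis_mem eU)/mem_nth.
by rewrite size_tuple.
Qed.

(** In an orthogonal basis the i-th diagonal entry of f^2 is
    <f (f e_i), e_i> / <e_i, e_i> = - |f e_i|^2 / |e_i|^2. *)
Lemma trace_sqr_skew_lt0 ip (f : 'End(V)) :
    (forall x y, ip (f x) y = - ip x (f y)) -> f != 0 ->
  lfun_trace (f \o f)%VF < 0.
Proof.
move=> f_skew f_neq0.
have [e [eV e_orth]] := orthogonal_basis ip fullv.
have e_gt0 := orthogonal_basis_gt0 ip eV.
pose nf i := ip (f e`_i) (f e`_i) / ip e`_i e`_i.
have nf_ge0 (i : 'I_(\dim {:V})) : 0 <= nf i.
  by rewrite divr_ge0 ?dot_ge0.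
have trE : lfun_trace (f \o f)%VF = - \sum_(i < \dim {:V}) nf i.
  rewrite (lfun_trace_basis _ eV) /mxtrace -sumrN; apply: eq_bigr => i _.
  rewrite !mxE /= vecof_delta comp_lfunE.
  by rewrite (orthogonal_coord eV e_orth) ?memvf // f_skew mulNr.
rewrite trE oppr_lt0 lt_def sumr_ge0 ?andbT => [|i _]; last exact: nf_ge0.
apply: contraNneq f_neq0 => sum0; apply/eqP/lfunP => v.
rewrite zero_lfunE (coord_basis eV (memvf v)) linear_sum big1 // => i _.
rewrite linearZ /=; suff /eqP -> : f e`_i == 0 by rewrite scaler0.
have /eqP := psumr_eq0P (P := xpredT) (fun j _ => nf_ge0 j) sum0 (i := i) isT.
by rewrite mulf_eq0 invr_eq0 dot_eq0 (gt_eqF (e_gt0 i)) orbF.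
Qed.

End InnerProduct.

(** * The Killing form and semisimplicity *)

Section LfunTrace.
Variables (R : fieldType) (V : vectType R).
Implicit Types f g : 'End(V).

Lemma lfun_trace0 : lfun_trace (0 : 'End(V)) = 0.
Proof. by rewrite /lfun_trace linear0 mxtrace0. Qed.

Lemma lfun_traceP a f g :
  lfun_trace (a *: f + g) = a * lfun_trace f + lfun_trace g.
Proof. by rewrite /lfun_trace !linearP. Qed.

Lemma lfun_traceB f g : lfun_trace (f - g) = lfun_trace f - lfun_trace g.
Proof. by rewrite addrC -scaleN1r lfun_traceP mulN1r addrC. Qed.

Lemma lfun_traceC f g : lfun_trace (f \o g)%VF = lfun_trace (g \o f)%VF.
Proof.
have eV := vbasisP {:V}.
by rewrite /lfun_trace !(mxof_comp _ _ eV) mxtrace_mulC.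
Qed.

End LfunTrace.

Section LieTheory.
Variables (R : fieldType) (g : lieAlgType R).
Implicit Types (x y z : g) (I : {vspace g}).

Lemma lie_anticomm x y : [Lie x, y] = - [Lie y, x].
Proof.
apply/eqP; rewrite -addr_eq0; apply/eqP.
have := lie_bracketxx (x + y).
by rewrite linearDl !linearDr /= !lie_bracketxx add0r addr0 addrC.
Qed.

(** The Jacobi identity, read as: [lie_bracket x] is a derivation. *)
Lemma lie_leibniz x y z :
  [Lie x, [Lie y, z]] = [Lie [Lie x, y], z] + [Lie y, [Lie x, z]].
Proof.
apply/eqP; rewrite -subr_eq0 opprD addrA -(lie_jacobi x y z).
rewrite (lie_anticomm z [Lie x, y]) (lie_anticomm z x) linearNr /=.
by rewrite addrAC.
Qed.

(** The bilinear structure of the bracket does not let inference see the partial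
    application [lie_bracket x] as a linear map, which [linfun] and hence [ad]
    require. *)
HB.instance Definition _ x :=
  GRing.isSemilinear.Build R g g _ (lie_bracket x)
    (GRing.semilinear_linear (lie_bracket_is_bilinear.2 x)).

Lemma adE x y : ad x y = [Lie x, y].
Proof. exact: lfunE. Qed.

Lemma ad_linear : linear (@ad R g).
Proof.
move=> a x y; apply/lfunP => z.
by rewrite add_lfunE scale_lfunE !adE linearPl.
Qed.

HB.instance Definition _ := GRing.isSemilinear.Build R g 'End(g) _ (@ad R g)
  (GRing.semilinear_linear ad_linear).

Lemma ad_bracket x y : ad [Lie x, y] = ((ad x \o ad y) - (ad y \o ad x))%VF.
Proof.
apply/lfunP => z.
by rewrite add_lfunE opp_lfunE !comp_lfunE !adE lie_leibniz addrK.
Qed.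

Lemma killing_sym x y : killing_form x y = killing_form y x.
Proof. exact: lfun_traceC. Qed.

Lemma killing_scalar y : scalar ((@killing_form R g)^~ y).
Proof.
move=> a u v; rewrite /killing_form linearP.
by rewrite comp_lfunDl -comp_lfunZl lfun_traceP.
Qed.

(** Invariance of the Killing form, on the diagonal: the traces of
    (ad x ad y) ad y and (ad y ad x) ad y agree by cyclicity. *)
Lemma killing_bracket_self x y : killing_form [Lie x, y] y = 0.
Proof.
rewrite /killing_form ad_bracket comp_lfunDl comp_lfunNl lfun_traceB.
by rewrite -[X in _ - lfun_trace X]comp_lfunA lfun_traceC comp_lfunA subrr.
Qed.

Definition lie_center : {vspace g} := lker (linfun (@ad R g)).

Lemma lie_centerP x : reflect (forall y, [Lie x, y] = 0) (x \in lie_center).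
Proof.
rewrite memv_ker lfunE /=; apply: (iffP eqP) => [adx0 y|adx0].
  by rewrite -adE adx0 zero_lfunE.
by apply/lfunP => y; rewrite adE zero_lfunE.
Qed.

Lemma lie_ideal_commutator I : lie_ideal I -> lie_ideal (lie_commutator I I).
Proof.
move=> idI x y.
rewrite {2}/lie_commutator => /(coord_span (X := in_tuple _)) ->.
rewrite linear_sumr; apply: rpred_sum => i _; rewrite linearZr_LR rpredZ //=.
have /allpairsP [[u v] /= [uI vI ->]] :
    (in_tuple [seq [Lie x, y] | x <- vbasis I, y <- vbasis I])`_i
      \in [seq [Lie x, y] | x <- vbasis I, y <- vbasis I].
  exact/mem_nth/ltn_ord.
rewrite lie_leibniz rpredD ?mem_lie_commutator ?idI //; exact: vbasis_mem.
Qed.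

End LieTheory.

(** By induction on the derived length, the
    commutator of a solvable ideal I vanishes, so I is abelian. For x in I, the
    map ad x sends g into I and then I to 0, whence K(x, x) = tr 0 = 0. *)
Lemma compact_type_semisimple (R : realFieldType) (g : lieAlgType R) :
  compact_type g -> lie_semisimple g.
Proof.
move=> g_compact I + [n]; elim: n I => [//|n IHn] I idI.
rewrite /derived_series iterSr => /(IHn _ (lie_ideal_commutator idI)) comm0.
apply/eqP; rewrite -subv0; apply/subvP => x xI; rewrite memv0.
apply: contraT => /g_compact; suff -> : killing_form x x = 0 by rewrite ltxx.
rewrite /killing_form; set f := (_ \o _)%VF; suff -> : f = 0.
  exact: lfun_trace0.
apply/lfunP => y; rewrite comp_lfunE !adE zero_lfunE; apply/eqP.
rewrite -memv0 -comm0 mem_lie_commutator //.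
by rewrite lie_anticomm rpredN idI.
Qed.

(** * Subalgebras and direct sums *)

Section Subalgebra.
Variables (R : fieldType) (g : lieAlgType R) (U : {vspace g}).
Hypothesis U_closed : lie_subalgebra U.

(** The closure proof is a phantom argument: it lets the Lie structure below be
    found from the type alone. *)
Definition subalgebra_of of lie_subalgebra U : Type := subvs_of U.
Local Notation h := (subalgebra_of U_closed).

HB.instance Definition _ := Vector.on h.

(** [vsproj U] only serves to return to the subtype, as the bracket already lies
    in [U]. *)
Definition subalgebra_bracket (x y : h) : h :=
  vsproj U [Lie vsval x, vsval y].

Lemma val_subalgebra_bracket x y :
  vsval (subalgebra_bracket x y) = [Lie vsval x, vsval y].
Proof. by rewrite vsprojK ?U_closed ?subvsP. Qed.

Fact subalgebra_bracket_is_bilinear :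
  (forall y, linear (subalgebra_bracket^~ y))
  * (forall x, linear (subalgebra_bracket x)).
Proof.
split=> [y|x] a u v; apply: val_inj.
  by rewrite [RHS]linearP /= !val_subalgebra_bracket linearP linearPl.
by rewrite [RHS]linearP /= !val_subalgebra_bracket !linearP.
Qed.

Fact subalgebra_bracketxx x : subalgebra_bracket x x = 0.
Proof.
by apply: val_inj; rewrite [RHS]linear0 /= val_subalgebra_bracket lie_bracketxx.
Qed.

Fact subalgebra_jacobi x y z :
  subalgebra_bracket x (subalgebra_bracket y z)
    + subalgebra_bracket y (subalgebra_bracket z x)
    + subalgebra_bracket z (subalgebra_bracket x y) = 0.
Proof.
apply: val_inj.
by rewrite [RHS]linear0 !linearD /= !val_subalgebra_bracket lie_jacobi.
Qed.

HB.instance Definition _ := Vector_isLie.Build R h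
  subalgebra_bracket_is_bilinear subalgebra_bracketxx subalgebra_jacobi.

Lemma vsval_bracket (x y : h) : vsval [Lie x, y] = [Lie vsval x, vsval y].
Proof. exact: val_subalgebra_bracket. Qed.

End Subalgebra.

Lemma daddv_pi_eq0 (R : fieldType) (V : vectType R) (U W : {vspace V}) w :
  (U :&: W = 0)%VS -> w \in W -> daddv_pi U W w = 0.
Proof.
move=> UW0 wW; apply: (addIr w); rewrite add0r.
rewrite -{2}(daddv_pi_id (U := W) (V := U) (u := w)) ?(capvC W) //.
by rewrite daddv_pi_add // (subvP (addvSr _ _)).
Qed.

Lemma lie_isomorphic_sym (R : fieldType) (g h : lieAlgType R) :
  lie_isomorphic g h -> lie_isomorphic h g.
Proof.
case=> f [[f' fK f'K] f_hom].
pose f'L := GRing.isSemilinear.Build R h g _ f'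
  (GRing.can2_semilinear fK f'K).
exists (HB.pack f' f'L : {linear h -> g}); split; first by exists f.
by move=> x y /=; rewrite -{1}[x]f'K -{1}[y]f'K -f_hom fK.
Qed.

Section DirectSumDecomposition.
Variables (R : fieldType) (g : lieAlgType R) (U V : {vspace g}).
Hypotheses (U_closed : lie_subalgebra U) (V_closed : lie_subalgebra V).
Hypotheses (UV0 : (U :&: V = 0)%VS) (UVf : (U + V = fullv)%VS).

(** The sum map (u, v) |-> u + v is bijective as U and V are complementary, and
    multiplicative as the mixed brackets vanish. *)
Lemma commuting_subalgebras_iso :
    {in U & V, forall x y, [Lie x, y] = 0} ->
  lie_isomorphic g (subalgebra_of U_closed * subalgebra_of V_closed)%type.
Proof.
move=> UV_comm; apply: lie_isomorphic_sym.
pose f (u : subalgebra_of U_closed * subalgebra_of V_closed) : g :=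
  vsval u.1 + vsval u.2.
have f_lin : linear f.
  by move=> a [u1 u2] [v1 v2]; rewrite /f /= scalerDr addrACA.
pose fM := GRing.isSemilinear.Build _ _ _ _ f (GRing.semilinear_linear f_lin).
exists (HB.pack f fM : {linear _ -> g}); split=> /= [|[x1 x2] [y1 y2]].
  exists (fun x => (vsproj U (daddv_pi U V x), vsproj V (daddv_pi V U x))).
    move=> [u1 u2]; rewrite /f /= !linearD /=.
    have VU0 : (V :&: U = 0)%VS by rewrite capvC.
    rewrite (daddv_pi_id UV0 (subvsP u1)) (daddv_pi_id VU0 (subvsP u2)).
    rewrite (daddv_pi_eq0 UV0 (subvsP u2)) (daddv_pi_eq0 VU0 (subvsP u1)).
    by rewrite !linear0 !vsvalK addr0 add0r.
  move=> x; rewrite /f /= !vsprojK ?memv_pi // daddv_pi_add //.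
  by rewrite UVf memvf.
rewrite /f /= !vsval_bracket linearDl !linearDr /=.
rewrite (UV_comm _ _ (subvsP x1) (subvsP y2)) addr0.
rewrite (lie_anticomm (vsval x2) (vsval y1)).
by rewrite (UV_comm _ _ (subvsP y1) (subvsP x2)) oppr0 add0r.
Qed.

End DirectSumDecomposition.

(** * Geodesics and invariant inner products *)

Section Geodesics.
Variables (R : realType) (g : lieAlgType R) (ip : innerProduct g).

(** With X = Y the Koszul formula is <nabla_Y Y, Z> = <[Z, Y], Y>. *)
Lemma all_geodesicP :
  (forall Y, Y != 0 -> geodesic ip Y) <-> (forall X Y, ip [Lie X, Y] Y = 0).
Proof.
split=> [geo X Y | ip0 Y Y_neq0].
  have [->|Y_neq0] := eqVneq Y 0; first by rewrite linear0r.
  have [_ [_ /(_ Y Y (memv_line Y) (memv_line Y))]] := geo Y Y_neq0.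
  move=> /vlineP[k nablaYY].
  have := levi_civitaP ip Y Y; rewrite nablaYY => kosz.
  (* Z = Y in the Koszul formula: the right-hand side is 0. *)
  have k0 : k = 0.
    have /eqP := kosz Y; rewrite !lie_bracketxx !linear0l !addr0 linearZl_LR /=.
    by rewrite !mulf_eq0 dot_eq0 pnatr_eq0 (negPf Y_neq0) orbF => /eqP.
  have /esym/eqP := kosz X.
  rewrite k0 scale0r lie_bracketxx !linear0l mulr0 add0r -mulr2n.
  by rewrite mulrn_eq0 => /eqP.
split=> //; split=> [_ _ /vlineP[a ->] /vlineP[b ->]|].
  by rewrite linearZl_LR linearZr_LR /= lie_bracketxx !scaler0 mem0v.
move=> _ _ /vlineP[a ->] /vlineP[b ->].
suff -> : levi_civita ip (a *: Y) (b *: Y) = 0 by apply: mem0v.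
apply: (koszul_uniq (levi_civitaP _ _ _)) => Z.
rewrite !(linearZl_LR, linearZr_LR) /= lie_bracketxx !ip0.
by rewrite !(linear0l, mulr0, addr0).
Qed.

End Geodesics.

Section InvariantInnerProduct.
Variables (R : realFieldType) (g : lieAlgType R) (ip : {dot g for idfun}).
Implicit Types x y z : g.
Hypothesis ip_inv : forall x y, ip [Lie x, y] y = 0.

(** Polarisation of the diagonal hypothesis [ip_inv]. *)
Lemma bracket_skew x y z : ip [Lie x, y] z = - ip y [Lie x, z].
Proof.
apply/eqP; rewrite -addr_eq0 (dot_sym ip y); apply/eqP.
have := ip_inv x (y + z).
by rewrite !linearDr /= !linearDl /= !ip_inv add0r addr0 addrC.
Qed.

Lemma killing_invariant_lt0 x : ad x != 0 -> killing_form x x < 0.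
Proof.
by apply: (@trace_sqr_skew_lt0 _ _ ip) => y z; rewrite !adE bracket_skew.
Qed.

Lemma bracket_orthov_center x y : [Lie x, y] \in orthov ip (lie_center g).
Proof.
apply/mem_orthovP => z /lie_centerP z_central.
by rewrite /= bracket_skew lie_anticomm z_central oppr0 linear0r oppr0.
Qed.

End InvariantInnerProduct.

(** * Invariant inner products and compact type *)

(** The restriction of [ip] to [U] is invariant, so a nonzero [x] in [U] has
    negative Killing norm unless ad x vanishes on [U], which the absence of a
    centre excludes. *)
Lemma invariant_compact_type (R : realFieldType) (g : lieAlgType R)
    (ip : {dot g for idfun}) (U : {vspace g}) (U_closed : lie_subalgebra U) :
    (forall x y : g, ip [Lie x, y] y = 0) ->
    (forall x, x \in U -> {in U, forall y, [Lie x, y] = 0} -> x = 0) ->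
  compact_type (subalgebra_of U_closed).
Proof.
move=> ip_inv U_centerless x x_neq0.
have [v k u w|u v|v v_neq0|ipU ipUE] := @dot_of_form R (subalgebra_of U_closed)
    (fun u v => ip (vsval u) (vsval v)).
- by rewrite linearP linearPl.
- exact: dot_sym.
- exact: neq0_dnorm_gt0.
apply: (@killing_invariant_lt0 _ _ ipU) => [u v|].
  by rewrite ipUE vsval_bracket ip_inv.
apply: contraNneq x_neq0 => adx0; apply/eqP/val_inj => /=.
apply: U_centerless (subvsP x) _ => y yU.
rewrite -(vsprojK yU) -(vsval_bracket (U_closed := U_closed)) -adE adx0.
by rewrite zero_lfunE linear0.
Qed.

(** The summands are the centre and its orthogonal complement. An element of
    the complement that commutes with the complement commutes with all of g,
    hence lies in both summands and is 0. *)
Lemma invariant_dot_decomposition (R : realFieldType) (g : lieAlgType R)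
    (ip : {dot g for idfun}) :
    (forall x y : g, ip [Lie x, y] y = 0) ->
  exists a s : lieAlgType R,
      [/\ lie_abelian a, lie_semisimple s, compact_type s
        & lie_isomorphic g (a * s)%type].
Proof.
move=> ip_inv; pose z := lie_center g; pose d := orthov ip z.
have z_closed : lie_subalgebra z.
  by move=> x y /lie_centerP xz _; rewrite xz mem0v.
have d_closed : lie_subalgebra d.
  by move=> x y _ _; apply: bracket_orthov_center.
have d_compact : compact_type (subalgebra_of d_closed).
  apply: (invariant_compact_type ip_inv) => x xd x_comm; apply/eqP.
  rewrite -memv0 -(capv_orthov ip z) memv_cap xd andbT; apply/lie_centerP => y.
  have : y \in (z + d)%VS by rewrite addv_orthov memvf.
  case/memv_addP => y1 /lie_centerP y1z [y2 y2d ->].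
  by rewrite linearDr /= lie_anticomm y1z oppr0 add0r x_comm.
exists (subalgebra_of z_closed), (subalgebra_of d_closed); split=> //.
- move=> x y; apply/val_inj; rewrite /= vsval_bracket.
  by have /lie_centerP -> := subvsP x.
- exact: compact_type_semisimple.
apply: commuting_subalgebras_iso; rewrite ?capv_orthov ?addv_orthov //.
by move=> x y /lie_centerP xz _.
Qed.

(** The inner product is the pullback along the isomorphism of an arbitrary one
    on [a] plus the opposite of the Killing form on [s]. *)
Lemma decomposition_invariant_dot (R : realFieldType) (g a s : lieAlgType R) :
    lie_abelian a -> compact_type s -> lie_isomorphic g (a * s)%type ->
  exists ip : {dot g for idfun}, forall x y : g, ip [Lie x, y] y = 0.
Proof.
move=> a_ab s_compact [f [f_bij f_hom]].
have [ipa] := exists_dot a.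
pose b x y := ipa (f x).1 (f y).1 - killing_form (f x).2 (f y).2.
have [v k x y|x y|x x_neq0|ip ipE] := @dot_of_form R g b.
- rewrite /b linearP /= linearPl (killing_scalar _ k) mulrBr /=.
  by rewrite opprD addrACA.
- by rewrite /b dot_sym killing_sym.
- rewrite /b.
  have : f x != 0 by rewrite (raddf_eq0 _ (bij_inj f_bij)).
  case: (f x) => u v /= uv_neq0.
  have [v0|v_neq0] := eqVneq v 0.
    rewrite v0 xpair_eqE eqxx andbT in uv_neq0 *.
    rewrite /killing_form linear0 comp_lfun0l lfun_trace0 subr0.
    exact: neq0_dnorm_gt0.
  by rewrite ltr_wpDl ?dot_ge0 // oppr_gt0 s_compact.
exists ip => x y; rewrite ipE /b f_hom /=.
by rewrite a_ab linear0l killing_bracket_self subrr.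
Qed.

Theorem proposition1p8 (R : realType) (g : lieAlgType R) :
  (exists ip : innerProduct g, forall Y : g, Y != 0 -> geodesic ip Y)
  <->
  (exists a s : lieAlgType R,
      [/\ lie_abelian a, lie_semisimple s, compact_type s
        & lie_isomorphic g (a * s)%type]).
Proof.
split=> [[ip /all_geodesicP] | [a [s [a_ab _ s_compact iso]]]].
  exact: invariant_dot_decomposition.
have [ip ip_inv] := decomposition_invariant_dot a_ab s_compact iso.
by exists ip; apply/all_geodesicP.
Qed.
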